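(* Let $(R,\mathfrak m)$ be a regular local ring containing a field, of dimension $n\ge 1$, and let $\mathfrak a_\bullet=\{\mathfrak a_m\}_{m\in\mathbb N}$ be a graded sequence of zero-dimensional ideals in $R$. Then: (1) $\operatorname{vol}(\mathfrak a_\bullet)=\mathrm e(\mathfrak a_\bullet)$. (2) $\operatorname{vol}(\mathfrak a_\bullet)>0$ if and only if there is an integer $q\ge 1$ such that $\mathfrak a_p\subseteq \mathfrak m^{[p/q]}$ for all $p\in\mathbb N$.
   Context: $\mathbb N$ includes $0$. A graded sequence of ideals in $R$ is a family $\{\mathfrak a_m\}_{m\in\mathbb N}$ of ideals with $\mathfrak a_p\cdot\mathfrak a_q\subseteq\mathfrak a_{p+q}$ for all $p,q\in\mathbb N$. It consists of zero-dimensional ideals if $\dim(R/\mathfrak a_m)\le 0$ for every $m$; the unit ideal $\mathfrak a_m=R$ is allowed. For a zero-dimensional ideal $I$, $\mathrm e(I)$ denotes the Hilbert–Samuel multiplicity of $R$ along $I$, with $\mathrm e(R)=0$, and $\ell$ denotes length. Put $\operatorname{vol}(\mathfrak a_\bullet)=\limsup_{m\to\infty} n!\,\ell(R/\mathfrak a_m)/m^n$ and $\mathrm e(\mathfrak a_\bullet)=\lim_{m\to\infty}\mathrm e(\mathfrak a_m)/m^n$; this limit exists. $[x]$ is the largest integer $\le x$, and $\mathfrak m^0=R$. *)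

(* Defs.v *)
From mathcomp Require Import all_boot all_order all_algebra.
From mathcomp Require Import all_classical all_reals all_analysis.

Set Implicit Arguments.
Unset Strict Implicit.
Unset Printing Implicit Defensive.

Import Order.TTheory GRing.Theory Num.Theory.
Import numFieldNormedType.Exports.

Local Open Scope classical_set_scope.
Local Open Scope ring_scope.

Section Ideals.
Variable R : comNzRingType.
Implicit Types (I J P m : set R) (n k : nat).

(* The [idealr] of [ring_quotient] is proper and decidable, whereas the unit
   ideal and arbitrary ideals are needed here. *)
Definition is_ideal I :=
  [/\ I 0, (forall x y, I x -> I y -> I (x + y))
    & (forall r x, I x -> I (r * x))].

Definition is_prime_ideal P :=
  [/\ is_ideal P, ~ P 1 & forall x y, P (x * y) -> P x \/ P y].

Definition is_maximal_ideal m :=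
  [/\ is_ideal m, ~ m 1
    & forall J, is_ideal J -> ~ J 1 -> m `<=` J -> J = m].

Definition ideal_gen n (g : 'I_n -> R) : set R :=
  [set x | exists c : 'I_n -> R, x = \sum_(i < n) c i * g i].

Definition ideal_mul I J : set R :=
  [set x | exists n (f g : 'I_n -> R),
     (forall i, I (f i) /\ J (g i)) /\ x = \sum_(i < n) f i * g i].

Definition ideal_exp I k : set R := iter k (ideal_mul I) setT.

Definition has_chain (C : set (set R)) k :=
  exists c : nat -> set R,
    (forall i, (i <= k)%N -> C (c i)) /\
    (forall i, (i < k)%N -> c i `<` c i.+1).

(* dim (R / I) <= 0, the primes of R / I being identified with the primes of
   R containing I; there are none when I is the unit ideal. *)
Definition zero_dim_ideal I :=
  is_ideal I /\
  forall k, has_chain [set P | is_prime_ideal P /\ I `<=` P] k -> (k <= 0)%N.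

(* The length of R / I, i.e. the supremum of the lengths of the chains of its
   submodules, which are identified with the ideals of R containing I. *)
Definition colength (K : realType) I : \bar K :=
  ereal_sup [set (k%:R)%:E | k in
    has_chain [set J | is_ideal J /\ I `<=` J]].

Definition graded_sequence (a : nat -> set R) :=
  (forall p, is_ideal (a p)) /\
  (forall p q, ideal_mul (a p) (a q) `<=` a (p + q)%N).

End Ideals.

Section Rings.
Variable R : comNzRingType.

Definition noetherian :=
  forall I : set R, is_ideal I -> exists n (g : 'I_n -> R), I = ideal_gen g.

Definition is_local (m : set R) :=
  is_maximal_ideal m /\ forall m', is_maximal_ideal m' -> m' = m.

Definition krull_dim_is (n : nat) :=
  has_chain (@is_prime_ideal R) n /\
  forall k, has_chain (@is_prime_ideal R) k -> (k <= n)%N.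

Definition regular_local (m : set R) (n : nat) :=
  [/\ noetherian, is_local m, krull_dim_is n
    & exists g : 'I_n -> R, m = ideal_gen g].

Definition contains_field :=
  exists (k : fieldType) (f : {rmorphism k -> R}), injective f.

End Rings.

(* In the next three definitions [n] stands for the dimension of R. The terms
   of index m = 0 (where m^n is inverted to 0) do not affect the limits. *)
Section Multiplicities.
Variables (K : realType) (R : comNzRingType) (n : nat).
Local Open Scope ereal_scope.

Definition hs_mult (I : set R) : \bar K :=
  limn (fun m : nat =>
    ((n`!)%:R / m%:R ^+ n)%:E * colength K (ideal_exp I m)).

Definition seq_vol (a : nat -> set R) : \bar K :=
  limn_esup (fun m : nat => ((n`!)%:R / m%:R ^+ n)%:E * colength K (a m)).

Definition seq_mult (a : nat -> set R) : \bar K :=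
  limn (fun m : nat => ((m%:R ^+ n)^-1)%:E * hs_mult (a m)).

End Multiplicities.

(* Main.v *)
(* Let x_1, ..., x_n generate m and order the monomials x^a by degree, then
   lexicographically.  Call a a leading exponent of an ideal I if
   x^a is in I + (x^b : b > a).  Filtering R by the ideals (x^b : b >= a), whose
   successive quotients are cyclic and killed by m, shows that l(R/I) is the
   number of exponents that are not leading exponents of I, as soon as I
   contains a power of m.  Leading exponents are compatible with products of
   ideals, so they reduce lengths to counting lattice points.

   Suppose m^N is contained in a_1 and write p = M k + r with r < M.  If c is a
   leading exponent of a_M, then j (k c + N r e_1) is one of (a_p)^j.  Counting
   the complement gives
     l(R/(a_p)^j) / (p j)^n <= l(R/a_M) / M^n + N^n M / p   for all M, p, j >= 1.
   Hence l(R/a_M)/M^n converges to its infimum w, and applying this also to the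
   powers of a_p, e(a_p)/p^n lies between n! w and n! (l(R/a_M)/M^n + N^n M/p).
   Thus vol and e both equal n! w.

   If some f in a_p is not in m^[p/q], then a_p has a leading exponent of degree
   less than [p/q], which forces l(R/a_p)/p^n <= N^(n-1)/q; so w = 0 if this
   happens for every q.  Conversely, a chain of n + 1 primes and the Artin-Rees
   lemma give l(R/m^k) >= c k^n with c > 0, so a_p in m^[p/q] forces w > 0. *)

Require Import Defs.
From mathcomp Require Import all_boot all_order all_algebra.
From mathcomp Require Import all_classical all_reals all_analysis.
From mathcomp Require Import ring lra zify.
From mathcomp Require mpoly.
Import -(notations) mpoly.

Set Implicit Arguments.
Unset Strict Implicit.
Unset Printing Implicit Defensive.

Import Order.TTheory GRing.Theory Num.Theory.
Import numFieldNormedType.Exports.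

Local Open Scope classical_set_scope.
Local Open Scope ring_scope.

(** * Ideals and monomials *)

Section IdealOperations.
Variable R : comNzRingType.
Implicit Types (I J K : set R) (f g h c : R).

Lemma ideal0 I : is_ideal I -> I 0. Proof. by case. Qed.

Lemma idealD I f g : is_ideal I -> I f -> I g -> I (f + g).
Proof. by case=> _ + _; apply. Qed.

Lemma idealMl I c f : is_ideal I -> I f -> I (c * f).
Proof. by case=> _ _; apply. Qed.

Lemma idealMr I c f : is_ideal I -> I f -> I (f * c).
Proof. by rewrite mulrC; apply: idealMl. Qed.

Lemma idealN I f : is_ideal I -> I f -> I (- f).
Proof. by rewrite -mulN1r; apply: idealMl. Qed.

Lemma idealB I f g : is_ideal I -> I f -> I g -> I (f - g).
Proof. by move=> hI If Ig; apply: idealD => //; apply: idealN. Qed.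

Lemma ideal_sum I (T : Type) (r : seq T) (P : pred T) (F : T -> R) :
  is_ideal I -> (forall i, P i -> I (F i)) -> I (\sum_(i <- r | P i) F i).
Proof.
by move=> hI IF; apply: big_ind => //; [exact: ideal0|move=> ? ?; exact: idealD].
Qed.

Lemma ideal_setT : is_ideal (@setT R). Proof. by split. Qed.

(** Taken as an intersection of ideals, so that an inclusion out of a span is checked on generators,
    without finite sums. *)
Definition ispan (S : set R) : set R :=
  [set f | forall I, is_ideal I -> S `<=` I -> I f].

Lemma ispan_ideal (S : set R) : is_ideal (ispan S).
Proof.
split=> [I hI _|f g Sf Sg I hI SI|c f Sf I hI SI].
- exact: ideal0.
- by apply: idealD => //; [apply: Sf|apply: Sg].
- by apply: idealMl => //; apply: Sf.
Qed.

Lemma sub_ispan (S : set R) : S `<=` ispan S.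
Proof. by move=> f Sf I _; apply. Qed.

Lemma ispan_min (S I : set R) : is_ideal I -> S `<=` I -> ispan S `<=` I.
Proof. by move=> hI SI f; apply. Qed.

Definition iadd I J : set R := [set f | exists g h, [/\ I g, J h & f = g + h]].

Lemma iadd_ideal I J : is_ideal I -> is_ideal J -> is_ideal (iadd I J).
Proof.
move=> hI hJ; split.
- by exists 0, 0; rewrite addr0; split=> //; apply: ideal0.
- move=> _ _ [f [g [If Jg ->]]] [f' [g' [If' Jg' ->]]].
  by exists (f + f'), (g + g'); rewrite addrACA; split=> //; apply: idealD.
- move=> c _ [f [g [If Jg ->]]].
  by exists (c * f), (c * g); rewrite mulrDr; split=> //; apply: idealMl.
Qed.

Lemma iadd_subl I J : is_ideal J -> I `<=` iadd I J.
Proof. by move=> hJ f If; exists f, 0; rewrite addr0; split=> //; apply: ideal0. Qed.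

Lemma iadd_subr I J : is_ideal I -> J `<=` iadd I J.
Proof. by move=> hI f Jf; exists 0, f; rewrite add0r; split=> //; apply: ideal0. Qed.

Lemma iadd_min I J K : is_ideal K -> I `<=` K -> J `<=` K -> iadd I J `<=` K.
Proof. by move=> hK IK JK _ [f [g [/IK Kf /JK Kg ->]]]; apply: idealD. Qed.

Lemma iaddSS I I' J J' : I `<=` I' -> J `<=` J' -> iadd I J `<=` iadd I' J'.
Proof. by move=> II' JJ' _ [f [g [/II' Kf /JJ' Kg ->]]]; exists f, g. Qed.

Definition principal f : set R := [set g | exists c, g = c * f].

Lemma principal_ideal f : is_ideal (principal f).
Proof.
split; first by exists 0; rewrite mul0r.
- by move=> _ _ [c ->] [d ->]; exists (c + d); rewrite mulrDl.
- by move=> c _ [d ->]; exists (c * d); rewrite mulrA.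
Qed.

Lemma principal_id f : principal f f. Proof. by exists 1; rewrite mul1r. Qed.

Lemma ideal_gen_ideal n (x : 'I_n -> R) : is_ideal (ideal_gen x).
Proof.
split; first by exists (fun=> 0); rewrite big1 // => i _; rewrite mul0r.
- move=> _ _ [c ->] [d ->]; exists (fun i => c i + d i).
  by rewrite -big_split; apply: eq_bigr => i _; rewrite mulrDl.
- move=> c _ [d ->]; exists (fun i => c * d i).
  by rewrite mulr_sumr; apply: eq_bigr => i _; rewrite mulrA.
Qed.

Lemma ideal_gen_mem n (x : 'I_n -> R) i : ideal_gen x (x i).
Proof.
exists (fun j => (j == i)%:R); rewrite (bigD1 i) //= eqxx mul1r big1 ?addr0 //.
by move=> j /negbTE ->; rewrite mul0r.
Qed.

Lemma ideal_gen_min n (x : 'I_n -> R) I :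
  is_ideal I -> (forall i, I (x i)) -> ideal_gen x `<=` I.
Proof.
by move=> hI Ix _ [c ->]; apply: ideal_sum => // i _; apply: idealMl.
Qed.

Lemma ideal_mul_mem I J f g : I f -> J g -> ideal_mul I J (f * g).
Proof.
by move=> If Jg; exists 1%N, (fun=> f), (fun=> g); rewrite big_ord1.
Qed.

Lemma ideal_mul_min I J K : is_ideal K ->
  (forall f g, I f -> J g -> K (f * g)) -> ideal_mul I J `<=` K.
Proof.
move=> hK hfg _ [n [f [g [IJ ->]]]]; apply: ideal_sum => // i _.
by apply: hfg; case: (IJ i).
Qed.

Lemma ideal_mul_ideal I J : is_ideal I -> is_ideal (ideal_mul I J).
Proof.
move=> hI; split.
- by exists 0%N, (fun=> 0), (fun=> 0); rewrite big_ord0; split=> // -[].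
- move=> _ _ [n [f [g [IJ ->]]]] [n' [f' [g' [IJ' ->]]]].
  exists (n + n')%N,
    (fun i => match fintype.split i with inl j => f j | inr j => f' j end),
    (fun i => match fintype.split i with inl j => g j | inr j => g' j end).
  split=> [i|]; first by case: fintype.split.
  rewrite big_split_ord /=; congr (_ + _); apply: eq_bigr => i _.
  + by have /= -> := unsplitK (inl i : 'I_n + 'I_n').
  + by have /= -> := unsplitK (inr i : 'I_n + 'I_n').
- move=> c _ [n [f [g [IJ ->]]]]; exists n, (fun i => c * f i), g.
  split=> [i|]; first by case: (IJ i) => ? ?; split=> //; apply: idealMl.
  by rewrite mulr_sumr; apply: eq_bigr => i _; rewrite mulrA.
Qed.

Lemma ideal_exp_ideal I k : is_ideal I -> is_ideal (ideal_exp I k).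
Proof.
by move=> hI; case: k => [|k]; [exact: ideal_setT|exact: ideal_mul_ideal].
Qed.

Lemma ideal_exp_mem I f k : I f -> ideal_exp I k (f ^+ k).
Proof.
by move=> If; elim: k => // k ih; rewrite exprS; apply: ideal_mul_mem.
Qed.

Lemma ideal_expD I j k f g : is_ideal I ->
  ideal_exp I j f -> ideal_exp I k g -> ideal_exp I (j + k) (f * g).
Proof.
move=> hI; elim: j f => [|j ih] f.
  by move=> _ kg; apply: idealMl => //; apply: ideal_exp_ideal.
move=> jf kg; move: f jf.
have hjk := @ideal_exp_ideal I (j.+1 + k) hI.
suff: ideal_exp I j.+1 `<=` [set f | ideal_exp I (j.+1 + k) (f * g)] by apply.
apply: ideal_mul_min => [|f f' If jf' /=].
  split=> [|f f' /= ? ?|c f /= ?].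
  - by rewrite /= mul0r; apply: ideal0.
  - by rewrite mulrDl; apply: idealD.
  - by rewrite -mulrA; apply: idealMl.
by rewrite -mulrA; apply: ideal_mul_mem => //; apply: ih.
Qed.

Lemma ideal_exp_le I j k : is_ideal I -> (j <= k)%N ->
  ideal_exp I k `<=` ideal_exp I j.
Proof.
move=> hI /subnKC <-; elim: (k - j)%N => [|d ih]; first by rewrite addn0.
rewrite addnS; apply: ideal_mul_min; first exact: ideal_exp_ideal.
by move=> f g _ /ih; apply: idealMl; apply: ideal_exp_ideal.
Qed.

Lemma ideal_exp1 I : is_ideal I -> ideal_exp I 1 = I.
Proof.
move=> hI; rewrite eqEsubset; split.
  by apply: ideal_mul_min => // f g If _; apply: idealMr.
by move=> f If; rewrite -(mulr1 f); apply: ideal_mul_mem.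
Qed.

(** Induction on [j] for all [K] at once: a factor [f] in [I] is absorbed by replacing [K] with the
    colon ideal of all [h] with [f * h] in [K]. *)
Lemma ideal_expD_min (I K : set R) j k : is_ideal I -> is_ideal K ->
  (forall f g, ideal_exp I j f -> ideal_exp I k g -> K (f * g)) ->
  ideal_exp I (j + k) `<=` K.
Proof.
move=> hI; elim: j K => [|j ih] K hK IK.
  by move=> f kf; rewrite -(mul1r f); apply: IK.
apply: ideal_mul_min => // f g If.
suff: ideal_exp I (j + k) `<=` [set h | K (f * h)] by apply.
apply: ih => [|h h' jh kh' /=].
  split=> [|h h' /= ? ?|c h /= ?].
  - by rewrite /= mulr0; apply: ideal0.
  - by rewrite mulrDr; apply: idealD.
  - by rewrite mulrCA; apply: idealMl.
by rewrite mulrA; apply: IK => //; apply: ideal_mul_mem.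
Qed.

Lemma ideal_expM (I J : set R) D j : is_ideal I -> is_ideal J ->
  ideal_exp I D `<=` J -> ideal_exp I (D * j) `<=` ideal_exp J j.
Proof.
move=> hI hJ IJ; elim: j => [|j ih]; first by rewrite muln0.
rewrite mulnS; apply: ideal_expD_min => // [|f g /IJ Jf /ih Jg].
  exact: (@ideal_exp_ideal _ j.+1).
exact: ideal_mul_mem.
Qed.

End IdealOperations.

Section Monomials.
Variables (R : comNzRingType) (n : nat) (x : 'I_n -> R).
Implicit Types (a b c : multinom n) (S : set (multinom n)).

Definition mono a : R := \prod_i x i ^+ a i.

Lemma mono0 : mono (@mnm0 n) = 1.
Proof. by rewrite /mono big1 // => i _; rewrite mnm0E expr0. Qed.

Lemma monoD a b : mono (mnm_add a b) = mono a * mono b.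
Proof. by rewrite /mono -big_split; apply: eq_bigr => i _; rewrite mnmDE exprD. Qed.

Lemma mono1 i : mono (mnm1 i) = x i.
Proof.
rewrite /mono (bigD1 i) //= mnm1E eqxx expr1 big1 ?mulr1 // => j ji.
by rewrite mnm1E eq_sym (negbTE ji) expr0.
Qed.

Definition mspan S : set R := ispan [set mono a | a in S].

Lemma mspan_ideal S : is_ideal (mspan S). Proof. exact: ispan_ideal. Qed.

Lemma mspan_mem S a : S a -> mspan S (mono a).
Proof. by move=> Sa; apply: sub_ispan; exists a. Qed.

Lemma mspan_min S I : is_ideal I -> (forall a, S a -> I (mono a)) -> mspan S `<=` I.
Proof. by move=> hI SI; apply: ispan_min => // _ [a /SI ? <-]. Qed.

Lemma mspanS S S' : S `<=` S' -> mspan S `<=` mspan S'.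
Proof.
by move=> SS'; apply: mspan_min; [exact: mspan_ideal|move=> a /SS'; exact: mspan_mem].
Qed.

Lemma mspanM S S' a f : (forall b, S b -> S' (mnm_add a b)) -> mspan S f ->
  mspan S' (mono a * f).
Proof.
move=> SS'.
suff: mspan S `<=` [set f | mspan S' (mono a * f)] by apply.
have hS' := mspan_ideal S'.
apply: mspan_min => [|b /SS' ? /=]; last by rewrite -monoD; apply: mspan_mem.
split=> [|g h /= ? ?|c g /= ?].
- by rewrite /= mulr0; apply: ideal0 hS'.
- by rewrite mulrDr; apply: (idealD hS').
- by rewrite mulrCA; apply: (idealMl _ hS').
Qed.

(** With [a] the least element of [S], this splits an element of the span into its lowest term and a
    part in later monomials. *)
Lemma mspanU1 S S' a : S `<=` [set b | b = a \/ S' b] ->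
  mspan S `<=` [set f | exists (r : R) g, mspan S' g /\ f = r * mono a + g].
Proof.
move=> SS'.
have hS' := mspan_ideal S'.
suff hI: is_ideal [set f | exists (r : R) g, mspan S' g /\ f = r * mono a + g].
  apply: mspan_min => // b /SS' [->|S'b].
    by exists 1, 0; rewrite mul1r addr0; split=> //; apply: ideal0 hS'.
  by exists 0, (mono b); rewrite mul0r add0r; split=> //; apply: mspan_mem.
split=> [|_ _ [c [g [? ->]]] [d [h [? ->]]]|d _ [c [g [? ->]]]].
- by exists 0, 0; rewrite mul0r addr0; split=> //; apply: ideal0 hS'.
- by exists (c + d), (g + h); rewrite mulrDl addrACA; split=> //; apply: (idealD hS').
- by exists (d * c), (d * g); rewrite mulrDr mulrA; split=> //; apply: (idealMl _ hS').
Qed.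

Notation m := (ideal_gen x).

Lemma exp_mono a : ideal_exp m (mdeg a) (mono a).
Proof.
rewrite mdegE /mono; elim: (index_enum _) => [|i s ih]; first by rewrite !big_nil.
rewrite !big_cons; apply: ideal_expD => //; first exact: ideal_gen_ideal.
exact/ideal_exp_mem/ideal_gen_mem.
Qed.

Lemma exp_mspan k : ideal_exp m k `<=` mspan [set a | mdeg a = k].
Proof.
elim: k => [|k ih] /=.
  move=> f _; rewrite -(mulr1 f) -mono0; apply: (idealMl _ (mspan_ideal _)).
  by apply: mspan_mem; rewrite /= mdeg0.
apply: ideal_mul_min; first exact: mspan_ideal.
move=> f g [c ->] /ih kg; rewrite mulr_suml; apply: ideal_sum => [|i _].
  exact: mspan_ideal.
rewrite -mulrA; apply: (idealMl _ (mspan_ideal _)).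
rewrite -mono1; apply: mspanM kg => b /= kb.
by rewrite mdegD mdeg1 kb.
Qed.

End Monomials.

(** * Noetherian local rings *)

Section NoetherianLocal.
Variable R : comNzRingType.
Hypothesis noeth : noetherian R.
Implicit Types (I J K : set R) (f g h c : R).

Lemma noetherian_acc (F : nat -> set R) : (forall i, is_ideal (F i)) ->
  (forall i, F i `<=` F i.+1) ->
  exists N, forall i, (N <= i)%N -> F i `<=` F N.
Proof.
move=> hF Fs.
have Fle i j : (i <= j)%N -> F i `<=` F j.
  move=> /subnKC <-; elim: (j - i)%N => [|d ih]; first by rewrite addn0.
  by rewrite addnS => f /ih /Fs.
have hU : is_ideal [set f | exists i, F i f].
  split=> [|f g [i If] [j Jg]|c f [i If]].
  - by exists 0%N; apply: ideal0.
  - exists (maxn i j); apply: idealD => //.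
    + exact: Fle (leq_maxl _ _) _ If.
    + exact: Fle (leq_maxr _ _) _ Jg.
  - by exists i; apply: idealMl.
have [k [g Ug]] := noeth hU.
have /choice[N FN] i : exists N, F N (g i).
  by have : [set f | exists i, F i f] (g i) by rewrite Ug; apply: ideal_gen_mem.
exists (\max_i N i) => i _ f Ff.
have : [set f | exists i, F i f] f by exists i.
rewrite Ug; apply: ideal_gen_min => // j.
exact: Fle (leq_bigmax j) _ (FN j).
Qed.

Lemma noetherian_max (C : set (set R)) I : (forall J, C J -> is_ideal J) -> C I ->
  exists M, [/\ C M, I `<=` M & forall J, C J -> M `<=` J -> J = M].
Proof.
move=> hC CI; apply: contrapT => /forallNP noM.
have /choice[F hF] J : exists J', C J -> I `<=` J -> [/\ C J', J `<=` J' & J' <> J].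
  have [[CJ IJ]|nJ] := pselect (C J /\ I `<=` J); last by exists J => ? ?; case: nJ.
  apply: contrapT => /forallNP nJ; apply: (noM J); split=> // J' CJ' JJ'.
  by apply: contrapT => neq; apply: (nJ J') => _ _; split.
have hi i : C (iter i F I) /\ I `<=` iter i F I.
  elim: i => [|i [Ci Ii]]; first by split.
  by have [? IF _] := hF _ Ci Ii; split=> // f /Ii /IF.
have [//|i|N hN] := @noetherian_acc (fun i => iter i F I).
- by move=> i; apply: hC; case: (hi i).
- by case: (hi i) => Ci Ii; have [] := hF _ Ci Ii.
have [CN IN] := hi N; have [_ NF] := hF _ CN IN; apply.
by rewrite eqEsubset; split=> //; apply: (hN N.+1).
Qed.

Variable m : set R.
Hypothesis local : is_local m.

Let m_ideal : is_ideal m. Proof. by case: local => [[]]. Qed.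

Lemma local_proper I : is_ideal I -> ~ I 1 -> I `<=` m.
Proof.
move=> hI nI1.
have [|//|M [[hM nM1] IM Mmax]] := @noetherian_max [set J | is_ideal J /\ ~ J 1] I.
  by move=> J [].
suff <- : M = m by [].
by case: local => _; apply; split=> // J hJ nJ1; apply: Mmax.
Qed.

Lemma local_unit c : ~ m c -> exists u, u * c = 1.
Proof.
move=> nmc; apply: contrapT => /forallNP nu; apply/nmc/(local_proper (principal_ideal c)).
  by move=> [u eu]; apply: (nu u).
exact: principal_id.
Qed.

Lemma local_prime : is_prime_ideal m.
Proof.
split=> // [|f g fg]; first by case: local => [[]].
have [//|/local_unit[u uf]] := pselect (m f); first by left.
by right; rewrite -(mul1r g) -uf -mulrA; apply: idealMl.
Qed.

(** Otherwise an ideal [M] maximal among those that contain [I] and no power of [f] is prime. It is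
    strictly below [m], which contains [f]: a chain of length 1 of primes over [I]. *)
Lemma zero_dim_nilpotent I f : zero_dim_ideal I -> m f -> exists k, I (f ^+ k).
Proof.
case=> hI dimI mf; apply: contrapT => /forallNP nI.
pose C J := [/\ is_ideal J, I `<=` J & forall k, ~ J (f ^+ k)].
have CI : C I by split.
have hC J : C J -> is_ideal J by case.
have [M [[hM IM nM] _ Mmax]] := noetherian_max hC CI.
have avoid g : ~ M g -> exists k, iadd M (principal g) (f ^+ k).
  move=> nMg; apply: contrapT => /forallNP nk; apply: nMg.
  have hMg := iadd_ideal hM (principal_ideal g).
  suff <- : iadd M (principal g) = M.
    by apply: iadd_subr => //; apply: principal_id.
  apply: Mmax; last by apply: iadd_subl; apply: principal_ideal.
  by split=> // h /IM Mh; apply: iadd_subl => //; apply: principal_ideal.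
have primeM : is_prime_ideal M.
  split=> //; first by have := nM 0%N; rewrite expr0.
  move=> g h Mgh; have [|/avoid[i [p [_ [Mp [r ->] ei]]]]] := pselect (M g).
    by left.
  have [|/avoid[j [q [_ [Mq [s ->] ej]]]]] := pselect (M h); first by right.
  exfalso; apply: (nM (i + j)%N); rewrite exprD ei ej.
  have -> : (p + r * g) * (q + s * h) =
      (q + s * h) * p + (r * g) * q + r * s * (g * h) by ring.
  by do !apply: idealD => //; apply: idealMl.
have Mm : M `<=` m by apply: local_proper => //; have := nM 0%N; rewrite expr0.
suff /dimI : has_chain [set P | is_prime_ideal P /\ I `<=` P] 1 by [].
exists (fun i => if i is 0%N then M else m); split.
  move=> [|i] _; split=> //; first exact: local_prime.
  by move=> g /IM /Mm.
move=> [|//] _; split=> // /(_ f mf) Mf.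
by apply: (nM 1%N); rewrite expr1.
Qed.

Lemma zero_dim_exp n (x : 'I_n -> R) I : m = ideal_gen x -> zero_dim_ideal I ->
  exists N, ideal_exp m N `<=` I.
Proof.
move=> mx zI; have hI : is_ideal I by case: zI.
have /choice[k Ik] i : exists k, I (x i ^+ k).
  by apply: zero_dim_nilpotent => //; rewrite mx; apply: ideal_gen_mem.
(* A monomial of degree above the sum of the [k i] has some exponent at least [k i], hence lies in
   [I]. *)
exists (\sum_i k i).+1; rewrite mx => f /exp_mspan; apply: mspan_min => //.
move=> a /= da.
have /existsP[i ki] : [exists i, (k i <= a i)%N].
  apply: contrapT => /negP; rewrite negb_exists => /forallP ak.
  have : (mdeg a <= \sum_i k i)%N.
    by rewrite mdegE; apply: leq_sum => i _; rewrite ltnW // ltnNge.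
  by rewrite da ltnn.
rewrite /mono (bigD1 i) //= -(subnK ki) exprD.
by apply: idealMr => //; apply: idealMl.
Qed.

End NoetherianLocal.

(** * Leading exponents and length *)

Definition finset_of (T : finType) (P : set T) : {set T} := finset (fun b => `[< P b >]).

Lemma finset_ofP (T : finType) (P : set T) b : reflect (P b) (b \in finset_of P).
Proof. by rewrite [_ \in _]inE; apply: asboolP. Qed.

(** * Exponents in a box and induction along the monomial order *)

Section Box.
Variable n : nat.

Lemma multinom_min (U : set (multinom n)) a : U a ->
  exists b, U b /\ forall c, U c -> (b <= c)%O.
Proof.
move: a; apply: ltmwf => a ih Ua.
have [[b ba Ub]|nb] := pselect (exists2 b, (b < a)%O & U b).
  exact: ih Ub.
by exists a; split=> // c Uc; rewrite leNgt; apply/negP => ca; apply: nb; exists c.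
Qed.

Definition box B (b : {ffun 'I_n -> 'I_B}) : multinom n :=
  Multinom [tuple (b i : nat) | i < n].

Lemma boxE B (b : {ffun 'I_n -> 'I_B}) i : box b i = b i.
Proof. exact: mnmE. Qed.

Lemma box_inj B : injective (@box B).
Proof.
by move=> b c /mnmP bc; apply/ffunP => i; apply/val_inj; rewrite /= -!boxE bc.
Qed.

Lemma boxP B (a : multinom n) : (forall i, a i < B)%N -> exists b, @box B b = a.
Proof.
move=> aB; exists [ffun i => Ordinal (aB i)].
by apply/mnmP => i; rewrite boxE ffunE.
Qed.

Lemma box_mdeg B (a : multinom n) : (mdeg a < B)%N -> exists b, @box B b = a.
Proof.
move=> aB; apply: boxP => i; apply: leq_ltn_trans aB.
by rewrite mdegE (bigD1 i) //= leq_addr.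
Qed.

Definition upset (U : set (multinom n)) := forall a b, U a -> (a <= b)%O -> U b.

Lemma upset_gt a : upset [set b | (a < b)%O].
Proof. by move=> b c; apply: lt_le_trans. Qed.

(** Descending induction in the monomial order: the least element of an up-set is removed until only
    degrees at least [D] remain. It stops because finitely many exponents have degree below [D]. *)
Lemma upset_ind D (P : set (multinom n) -> Prop) :
  (forall U, (forall a, U a -> (D <= mdeg a)%N) -> P U) ->
  (forall U a, upset U -> U a -> (forall b, U b -> (a <= b)%O) -> (mdeg a < D)%N ->
     P [set b | (a < b)%O] -> P U) ->
  forall U, upset U -> P U.
Proof.
move=> P0 PS U; have [k] := ubnP #|finset_of [set b : {ffun 'I_n -> 'I_D} | U (box b)]|.
elim: k U => // k ih U; rewrite ltnS => Uk upU.
have [[a0 Ua0]|noU] := pselect (exists a, U a); last first.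
  by apply: P0 => a Ua; case: noU; exists a.
have [a [Ua amin]] := multinom_min Ua0.
have [Da|aD] := leqP D (mdeg a).
  by apply: P0 => b /amin /lemc_mdeg; apply: leq_trans.
apply: (PS _ _ upU Ua amin aD); apply: ih; last exact: upset_gt.
apply: leq_trans Uk; apply: proper_card.
have [b ab] := box_mdeg aD.
apply/fintype.properP; split; last first.
  by exists b; [apply/finset_ofP|apply/finset_ofP]; rewrite /= ab ?ltxx.
apply/fintype.subsetP => c /finset_ofP /= ac; apply/finset_ofP.
exact/(upU _ _ Ua)/ltW.
Qed.

End Box.

Section LeadingExponents.
Variables (R : comNzRingType) (n : nat) (x : 'I_n -> R).
Implicit Types (I J : set R) (a b c : multinom n) (U : set (multinom n)).

Notation mono := (mono x).
Notation mspan := (mspan x).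
Notation m := (ideal_gen x).

Definition tail a : set R := mspan [set b | (a < b)%O].

Definition lead I a : Prop := iadd I (tail a) (mono a).

Lemma tail_ideal a : is_ideal (tail a). Proof. exact: mspan_ideal. Qed.

Lemma tailM a b f : tail b f -> tail (mnm_add a b) (mono a * f).
Proof. by apply: mspanM => c /=; rewrite ltmc_add2r. Qed.

Lemma tailMM a b f g : tail a f -> tail b g -> tail (mnm_add a b) (f * g).
Proof.
move=> taf tbg.
suff: tail a `<=` [set f | tail (mnm_add a b) (f * g)] by apply.
have hab := tail_ideal (mnm_add a b).
apply: mspan_min => [|c /= ac].
  split=> [|h h' /= ? ?|r h /= ?].
  - by rewrite /= mul0r; apply: ideal0 hab.
  - by rewrite mulrDl; apply: (idealD hab).
  - by rewrite -mulrA; apply: (idealMl _ hab).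
by apply: mspanM tbg => d /= bd; apply: ltm_add.
Qed.

(** If x^a = f + h and x^b = g + h', then x^(a+b) - f g lies in the tail of a + b. The condition on
    [K] covers products a_p a_q, powers and multiples by ring elements alike. *)
Lemma leadM I J K a b : is_ideal K -> (forall f g, I f -> J g -> K (f * g)) ->
  lead I a -> lead J b -> lead K (mnm_add a b).
Proof.
move=> hK IJK [f [h [If ah ea]]] [g [h' [Jg bh' eb]]].
have hT := tail_ideal (mnm_add a b).
exists (f * g), (mono a * h' + mono b * h - h * h').
split; [exact: IJK| |by rewrite monoD ea eb; ring].
apply: (idealB hT); last exact: tailMM.
by apply: (idealD hT); [|rewrite addmC]; apply: tailM.
Qed.

Lemma leadD I a b : is_ideal I -> lead I a -> lead I (mnm_add a b).
Proof.
move=> hI /leadM; apply=> // [f g If _|]; last first.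
  exact: (iadd_subl (tail_ideal b) (I := setT)).
exact: idealMr.
Qed.

Lemma lead_le I a b : is_ideal I -> (forall i, a i <= b i)%N -> lead I a -> lead I b.
Proof. by move=> hI /mnm_lepP /submK <- /(leadD (mnm_sub b a) hI); rewrite addmC. Qed.

Lemma leadS I J a : I `<=` J -> lead I a -> lead J a.
Proof. by move=> IJ; apply: iaddSS. Qed.

Lemma lead_mono I a : I (mono a) -> lead I a.
Proof. by move=> Ia; apply: iadd_subl => //; apply: tail_ideal. Qed.

Lemma leadX I a k : is_ideal I -> lead I a -> lead (ideal_exp I k) (mnm_muln a k).
Proof.
move=> hI Ia; elim: k => [|k ih]; first exact: lead_mono.
rewrite mulmS; apply: leadM Ia ih; first exact: ideal_exp_ideal.
exact: ideal_mul_mem.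
Qed.

Lemma lead_mdeg I D a : ideal_exp m D `<=` I -> (D <= mdeg a)%N -> lead I a.
Proof.
move=> mI Da; apply/lead_mono/mI/(ideal_exp_le _ Da); first exact: ideal_gen_ideal.
exact: exp_mono.
Qed.

Lemma upset_min U a : (forall b, U b -> (a <= b)%O) ->
  U `<=` [set b | b = a \/ (a < b)%O].
Proof. by move=> Ua b /Ua; rewrite le_eqVlt => /predU1P[->|]; [left|right]. Qed.

Hypothesis unit_out : forall c : R, ~ m c -> exists u, u * c = 1.

(** Degree comes first in the order, so multiplying by a generator of [m] moves a monomial strictly
    later. *)
Lemma maximal_mono_tail (c : R) a : m c -> tail a (c * mono a).
Proof.
case=> d ->; rewrite mulr_suml; apply: ideal_sum => [|i _]; first exact: tail_ideal.
rewrite -mulrA; apply: (idealMl _ (tail_ideal a)).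
rewrite -mono1 -monoD; apply: mspan_mem.
by apply: lt_mdeg_ltmc; rewrite mdegD mdeg1.
Qed.

(** Division as for standard bases: the lowest term of an element of [J'] is cancelled by an element
    of [J] with the same leading exponent, and the remainder has later terms; from degree [D] on,
    all monomials lie in [J]. *)
Lemma lead_inj I J J' D : is_ideal J -> is_ideal J' -> ideal_exp m D `<=` J ->
  J `<=` J' -> (forall a, lead J' a -> lead J a) -> J' `<=` J.
Proof.
move=> hJ hJ' mJ JJ' leadJ.
suff main U : upset U -> J' `&` mspan U `<=` J.
  move=> f J'f; apply: (main setT (fun _ _ _ _ => Logic.I)); split=> //.
  rewrite -(mulr1 f) -(mono0 x); apply: (idealMl _ (mspan_ideal _ _)).
  exact: mspan_mem.
move: U; apply: (@upset_ind _ D) => [U UD f [_]|U a upU Ua amin aD IH f [J'f Uf]].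
  apply: mspan_min => // b /UD Db; apply/mJ/(ideal_exp_le _ Db) => //.
    exact: ideal_gen_ideal.
  exact: exp_mono.
have := mspanU1 (upset_min amin) Uf; case=> c [h [ah ef]].
(* A coefficient in [m] sends the term to the tail; any other is invertible and makes [a] a leading
   exponent of [J']. *)
have [mc|/unit_out[u uc]] := pselect (m c).
  apply: IH; split=> //; rewrite ef.
  by apply: (idealD (tail_ideal a)) => //; apply: maximal_mono_tail.
have J'a : lead J' a.
  exists (u * f), (- (u * h)); split; first exact: idealMl.
    by apply: (idealN (tail_ideal a)); apply: (idealMl _ (tail_ideal a)).
  by rewrite ef mulrDr addrK mulrA uc mul1r.
have [g [h' [Jg ah' ea]]] := leadJ _ J'a.
rewrite -(subrK (c * g) f); apply: idealD => //; last exact: idealMl.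
apply: IH; split; first by apply: idealB => //; apply: idealMl => //; apply: JJ'.
have -> : f - c * g = c * h' + h by rewrite ef ea; ring.
by apply: (idealD (tail_ideal a)) => //; apply: (idealMl _ (tail_ideal a)).
Qed.

(** The box makes the set finite. It loses no exponent when m^D lies in [I] for some [D <= B], every
    exponent of degree at least [D] then being leading. *)
Definition colead B I : {set {ffun 'I_n -> 'I_B}} :=
  finset_of [set b | ~ lead I (box b)].

(** By [lead_inj], each strict inclusion in the chain makes at least one more exponent of the box
    leading. *)
Lemma chain_leq_colead I D B k : ideal_exp m D `<=` I -> (D <= B)%N ->
  has_chain [set J | is_ideal J /\ I `<=` J] k -> (k <= #|colead B I|)%N.
Proof.
move=> mI DB [c [cI cs]].
suff: forall i, (i <= k)%N -> (i + #|colead B (c i)| <= #|colead B I|)%N.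
  by move=> /(_ _ (leqnn k)); apply: leq_trans; rewrite leq_addr.
elim=> [|i ih] ik.
  rewrite add0n; apply/subset_leq_card/fintype.subsetP => b /finset_ofP nb.
  by apply/finset_ofP => Ib; apply: nb; apply: leadS Ib; case: (cI _ ik).
have [[hi Ii] [hi1 Ii1]] := (cI _ (ltnW ik), cI _ ik).
have [ss nss] := cs _ ik.
apply: leq_trans (ih (ltnW ik)); rewrite addSnnS leq_add2l; apply: proper_card.
apply/fintype.properP; split.
  apply/fintype.subsetP => b /finset_ofP nb.
  by apply/finset_ofP => Ib; apply: nb; apply: leadS Ib.
apply: contrapT => /forall2NP nb; apply: nss.
apply: (@lead_inj I _ _ D) => //; first by apply: subset_trans Ii.
move=> a c1a; have [aB|Ba] := ltnP (mdeg a) B; last first.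
  by apply: lead_mdeg (leq_trans DB Ba); apply: subset_trans Ii.
have [b ab] := box_mdeg aB; subst a.
apply: contrapT => nib; case: (nb b); apply; first exact/finset_ofP.
by apply/negP => /finset_ofP; apply.
Qed.

(** Spans of growing up-sets are added to [I], each containing one more non-leading exponent [b] of
    the box, smaller than the former ones. The ideal grows strictly, as x^b is not in
    [iadd I (tail b)]. *)
Lemma chain_colead I B : is_ideal I ->
  has_chain [set J | is_ideal J /\ I `<=` J] #|colead B I|.
Proof.
move=> hI.
suff main k : forall U, upset U ->
    (#|colead B I :&: finset_of [set b | U (box b)]| = k)%N ->
    exists c : nat -> set R, [/\ forall i, (i <= k)%N -> is_ideal (c i) /\ I `<=` c i,
      forall i, (i < k)%N -> c i `<` c i.+1 & c k `<=` iadd I (mspan U)].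
  have [c [cI cs _]] := main _ setT (fun _ _ _ _ => Logic.I) erefl.
  suff <- : colead B I :&: finset_of [set b | setT (box b)] = colead B I by exists c.
  by apply/finset.setIidPl/fintype.subsetP => b _; apply/finset_ofP.
elim: k => [|k ih] U upU Uk.
  exists (fun=> I); split=> [i _|//|]; [by split|exact: (iadd_subl (mspan_ideal _ _))].
have [b0 Ub0] : exists b : {ffun 'I_n -> 'I_B},
    b \in colead B I :&: finset_of [set b | U (box b)].
  by apply/set0Pn; rewrite -cards_eq0 Uk.
pose V a := exists2 b : {ffun 'I_n -> 'I_B},
  b \in colead B I :&: finset_of [set b | U (box b)] & box b = a.
have [|_ [[b Vb <-] bmin]] := @multinom_min n V (box b0); first by exists b0.
have := Vb; rewrite finset.in_setI => /andP[/finset_ofP nlb /finset_ofP Ub].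
have [|c [cI cs ck]] := ih [set a | (box b < a)%O] (@upset_gt _ _).
  apply/eqP; rewrite -eqSS -Uk [in eqbRHS](cardsD1 b) Vb add1n eqSS; apply/eqP.
  apply: eq_card => d; rewrite [LHS]finset.in_setI [RHS]finset.in_setD1 finset.in_setI.
  apply/andP/and3P => [[nld /finset_ofP /= bd]|[db nld /finset_ofP Ud]]; split=> //.
  - by apply: contraTN bd => /eqP ->; rewrite ltxx.
  - exact/finset_ofP/(upU _ _ Ub)/ltW.
  - apply/finset_ofP; rewrite /= lt_neqAle eq_sym (inj_eq (@box_inj _ _)) db.
    by apply: bmin; exists d => //; rewrite finset.in_setI nld; apply/finset_ofP.
have bU : [set a | (box b < a)%O] `<=` U by move=> a /ltW; apply: upU.
exists (fun i => if (i <= k)%N then c i else iadd I (mspan U)); split.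
- move=> i _; case: ifP => [|_]; first exact: cI.
  by split; [apply: iadd_ideal|apply: iadd_subl] => //; apply: mspan_ideal.
- move=> i; rewrite ltnS /= => ik; rewrite ik.
  have := ik; rewrite leq_eqVlt => /predU1P[->|ltik]; last first.
    by rewrite ltik; apply: cs.
  rewrite ltnn; split.
    by apply: subset_trans ck _; apply: iaddSS => //; apply: mspanS.
  move=> /(_ (mono (box b))) nb; apply/nlb/ck/nb.
  by apply: iadd_subr => //; apply: mspan_mem.
- by rewrite /= ltnn.
Qed.

Lemma colengthE (K : realType) I D B : is_ideal I -> ideal_exp m D `<=` I -> (D <= B)%N ->
  colength K I = (#|colead B I|%:R)%:E.
Proof.
move=> hI mI DB; apply/eqP; rewrite eq_le; apply/andP; split.
  apply: ub_ereal_sup => _ [k /(chain_leq_colead mI DB) kB <-].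
  by rewrite lee_fin ler_nat.
by apply: ereal_sup_ubound; exists #|colead B I| => //; apply: chain_colead.
Qed.

End LeadingExponents.

(** * Counting exponents *)

Section Counting.
Variable n : nat.
Implicit Types G H : set (multinom n.+1).

Lemma card_slab B t (i : 'I_n.+1) :
  (#|finset_of [set b : {ffun 'I_n.+1 -> 'I_B} | (b i < t)%N]| <= t * B ^ n)%N.
Proof.
(* The case [t = 0] is apart because [inord], used below, needs a nonempty ordinal type. *)
case: t => [|t].
  rewrite mul0n leqn0 cards_eq0; apply/eqP/finset.setP => b; rewrite finset.in_set0.
  by apply/negP => /finset_ofP /=; rewrite ltn0.
pose f (b : {ffun 'I_n.+1 -> 'I_B}) : 'I_t.+1 * {ffun 'I_n -> 'I_B} :=
  (inord (b i), [ffun j => b (lift i j)]).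
rewrite -(@card_in_imset _ _ f) => [|b c /finset_ofP /= bt /finset_ofP /= ct].
  apply: leq_trans (max_card _) _.
  by rewrite card_prod card_ffun !card_ord.
case=> /(congr1 val); rewrite /= !inordK // => bci /ffunP bcl.
apply/ffunP => j; case: (unliftP i j) => [j'|] ->; last exact: val_inj.
by have := bcl j'; rewrite !ffunE.
Qed.

Definition cofin B G : {set {ffun 'I_n.+1 -> 'I_B}} := finset_of [set b | ~ G (box b)].

(* A box exponent [a] outside [G] either has [a_0 < t], or its quotient by [k]
   after subtracting [t] from [a_0] is outside [H]; that quotient and the
   remainders determine [a]. *)
Lemma card_cofin_dilate G H (k t B C : nat) :
  (forall a b : multinom n.+1, (forall i, a i <= b i)%N -> G a -> G b) ->
  (exists c, H c) -> (forall c : multinom n.+1, ~ H c -> forall i, (c i < C)%N) ->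
  (forall c, H c -> G (mnm_add (mnm_muln c k) (mnm_muln (mnm1 ord0) t))) ->
  (#|cofin B G| <= t * B ^ n + k ^ n.+1 * #|cofin C H|)%N.
Proof.
move=> upG [c0 Hc0] boxH HG.
pose slab := finset_of [set b : {ffun 'I_n.+1 -> 'I_B} | (b ord0 < t)%N].
have -> : #|cofin B G| = (#|cofin B G :&: slab| + #|cofin B G :\: slab|)%N.
  by rewrite cardsID.
apply: leq_add.
  apply: leq_trans (card_slab B t ord0).
  exact/subset_leq_card/finset.subsetIr.
have slabN b : b \in cofin B G :\: slab -> ~ G (box b) /\ (t <= b ord0)%N.
  rewrite finset.in_setD => /andP[/finset_ofP bt /finset_ofP]; split=> //.
  by rewrite leqNgt; apply/negP.
(* For [k = 0] the last hypothesis puts t e_0 in [G], so every exponent outside [G] lies in the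
   slab. *)
case: k => [|k] in HG *.
  rewrite exp0n // mul0n leqn0 cards_eq0; apply/eqP/finset.setP => b.
  rewrite finset.in_set0; apply/negP => /slabN[nG tb]; apply/nG/upG/(HG _ Hc0) => i.
  rewrite mnmDE !mulmnE mnm1E muln0 add0n boxE.
  by case: eqP => [<-|_]; rewrite ?mul1n.
pose q (b : {ffun 'I_n.+1 -> 'I_B}) : multinom n.+1 :=
  Multinom [tuple ((box b i - t * (i == ord0)) %/ k.+1)%N | i < n.+1].
have qE b i : q b i = ((b i - t * (i == ord0)) %/ k.+1)%N by rewrite mnmE boxE.
have qP b : b \in cofin B G :\: slab -> ~ H (q b).
  move=> /slabN[nG tb] /HG Gq; apply/nG/upG/Gq => i.
  rewrite mnmDE !mulmnE mnm1E (eq_sym ord0) qE boxE.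
  have tbi : (t * (i == ord0) <= b i)%N by case: eqP => [->|_]; rewrite ?muln1 ?muln0.
  rewrite [((i == _) * t)%N]mulnC -[leqRHS](subnK tbi) leq_add2r.
  exact: leq_trunc_div.
(* A nonempty set yields an element [c1] of the box of side [C], the default value of the choice
   function below. *)
have [->|[b0 /qP/boxH/boxP[c1 _]]] := finset.set_0Vmem (cofin B G :\: slab).
  by rewrite cards0.
have [f fE] : exists f : {ffun 'I_n.+1 -> 'I_B} -> {ffun 'I_n.+1 -> 'I_C},
    forall b, b \in cofin B G :\: slab -> box (f b) = q b.
  have /choice[f fE] b : exists c : {ffun 'I_n.+1 -> 'I_C},
      b \in cofin B G :\: slab -> box c = q b.
    have [bS|bS] := boolP (b \in cofin B G :\: slab); last by exists c1.
    by have [c cq] := boxP (boxH _ (qP _ bS)); exists c.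
  by exists f.
pose g (b : {ffun 'I_n.+1 -> 'I_B}) : {ffun 'I_n.+1 -> 'I_k.+1} :=
  [ffun i => inord ((b i - t * (i == ord0)) %% k.+1)].
rewrite -(@card_in_imset _ _ (fun b => (g b, f b))) => [|b c bS cS [/ffunP gbc fbc]].
  have -> : (k.+1 ^ n.+1 * #|cofin C H|)%N =
      #|finset.setX [set: {ffun 'I_n.+1 -> 'I_k.+1}]%SET (cofin C H)|.
    by rewrite cardsX cardsT card_ffun !card_ord.
  apply/subset_leq_card/fintype.subsetP => _ /imsetP[b bS ->].
  rewrite finset.in_setX finset.in_setT; apply/finset_ofP.
  by rewrite /= fE //; apply: qP.
apply/ffunP => i; apply/val_inj => /=.
have tbi d : d \in cofin B G :\: slab -> (t * (i == ord0) <= d i)%N.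
  by move=> /slabN[_ td]; case: eqP => [->|_]; rewrite ?muln1 ?muln0.
rewrite -(subnK (tbi b bS)) -(subnK (tbi c cS)); congr (_ + _)%N.
rewrite (divn_eq (b i - _) k.+1) (divn_eq (c i - _) k.+1); congr (_ * _ + _)%N.
  by rewrite -!qE -!fE // fbc.
by have := congr1 val (gbc i); rewrite !ffunE /= !inordK // ltn_mod.
Qed.

End Counting.

(** * Leading exponents of graded sequences *)

Section GradedLeading.
Variables (R : comNzRingType) (n : nat) (x : 'I_n.+1 -> R).
Notation m := (ideal_gen x).
Hypothesis unit_out : forall c : R, ~ m c -> exists u, u * c = 1.

(** Otherwise I + m^D and m^D have the same leading exponents, as m^D lies in the tail of every
    exponent of degree below [D]; then they are equal and contain [f]. *)
Lemma lead_of_notin_exp (I : set R) f D : is_ideal I -> I f -> ~ ideal_exp m D f ->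
  exists c, (mdeg c < D)%N /\ lead x I c.
Proof.
move=> hI If nDf; have hE := @ideal_exp_ideal _ m D (ideal_gen_ideal x).
have hJ := iadd_ideal hI hE.
apply: contrapT => /forallNP nc; apply/nDf.
suff: iadd I (ideal_exp m D) `<=` ideal_exp m D by apply; apply: iadd_subl.
apply: (@lead_inj _ _ x unit_out I _ _ D) => //; first exact: iadd_subr.
move=> c lc; have [cD|Dc] := ltnP (mdeg c) D; last exact: lead_mdeg Dc.
exfalso; apply: (nc c); split=> //.
have [_ [h [[g [e [Ig De ->]]] ch ec]]] := lc.
exists g, (e + h); split=> //; last by rewrite addrA.
apply: (idealD (tail_ideal x c)) => //.
move: (exp_mspan De); apply: mspanS => b /= bD.
by apply: lt_mdeg_ltmc; rewrite bD.
Qed.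

Variables (a : nat -> set R) (N : nat).
Hypothesis a_graded : graded_sequence a.
Hypothesis a1N : ideal_exp m N `<=` a 1%N.

Let hm : is_ideal m := ideal_gen_ideal x.
Let ha p : is_ideal (a p). Proof. by case: a_graded. Qed.
Let aM p q f g : a p f -> a q g -> a (p + q)%N (f * g).
Proof. by case: a_graded => _ aD pf qg; apply/aD/ideal_mul_mem. Qed.

Lemma graded_exp_sub p j : ideal_exp (a p.+1) j.+1 `<=` a (p.+1 * j.+1)%N.
Proof.
elim: j => [|j ih]; first by rewrite ideal_exp1 // muln1.
rewrite mulnS; apply: ideal_mul_min => // f g pf /ih.
exact: aM.
Qed.

Lemma graded_contains_exp p : ideal_exp m (N * p.+1) `<=` a p.+1.
Proof.
elim: p => [|p ih]; first by rewrite muln1.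
by rewrite mulnS; apply: ideal_expD_min => // f g /a1N af /ih; apply: (@aM 1).
Qed.

(** The side N p j of the box fits the inclusion of m^(N p j) in (a_p)^j, valid for p >= 1. *)
Definition colen p j := #|colead x (N * p * j) (ideal_exp (a p) j)|.

Let contains_exp p j : ideal_exp m (N * p.+1 * j) `<=` ideal_exp (a p.+1) j.
Proof. by apply: ideal_expM => //; apply: graded_contains_exp. Qed.

Lemma colength_exp (K : realType) p j :
  colength K (ideal_exp (a p.+1) j) = (colen p.+1 j)%:R%:E.
Proof.
apply: (colengthE unit_out) (leqnn _); first exact: ideal_exp_ideal.
exact: contains_exp.
Qed.

Lemma colength_graded (K : realType) p : colength K (a p.+1) = (colen p.+1 1)%:R%:E.
Proof. by rewrite -colength_exp ideal_exp1. Qed.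

Lemma colen_graded_le p j : (colen (p.+1 * j.+1) 1 <= colen p.+1 j.+1)%N.
Proof.
rewrite /colen muln1 mulnA; apply/subset_leq_card/fintype.subsetP => b /finset_ofP nb.
apply/finset_ofP => lb; apply: nb; apply: leadS lb.
by rewrite ideal_exp1 //; apply: graded_exp_sub.
Qed.

Lemma lead_graded p q c d : lead x (a p) c -> lead x (a q) d ->
  lead x (a (p + q)%N) (mnm_add c d).
Proof. by apply: leadM => // f g; apply: aM. Qed.

Lemma lead_gradedMn p k c : lead x (a p) c ->
  lead x (a (p * k.+1)%N) (mnm_muln c k.+1).
Proof.
move=> lc; elim: k => [|k ih]; first by rewrite muln1 mulmS mulm0n addm0.
by rewrite mulnS mulmS; apply: lead_graded.
Qed.

Lemma lead_graded1 r : lead x (a r.+1) (mnm_muln (mnm1 ord0) (N * r.+1)).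
Proof.
by apply: lead_mdeg (@graded_contains_exp r) _; rewrite mdegMn mdeg1 mul1n.
Qed.

Lemma lead_graded_div M p c : lead x (a M.+1) c ->
  lead x (a p.+1) (mnm_add (mnm_muln c (p.+1 %/ M.+1))
                           (mnm_muln (mnm1 ord0) (N * (p.+1 %% M.+1)))).
Proof.
move=> lc; rewrite [X in a X](divn_eq p.+1 M.+1) mulnC.
have := divn_eq p.+1 M.+1.
case: (p.+1 %/ M.+1)%N => [|k]; case: (p.+1 %% M.+1)%N => [|r] // _.
- by rewrite muln0 add0n mulm0n add0m; apply: lead_graded1.
- by rewrite addn0 muln0 mulm0n addm0; apply: lead_gradedMn.
- by apply: lead_graded; [apply: lead_gradedMn|apply: lead_graded1].
Qed.

Lemma colen_div_bound M p j :
  (colen p.+1 j <= N * (p.+1 %% M.+1) * j * (N * p.+1 * j) ^ n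
                   + (p.+1 %/ M.+1 * j) ^ n.+1 * colen M.+1 1)%N.
Proof.
apply: card_cofin_dilate.
- by move=> c d; apply: lead_le; apply: ideal_exp_ideal.
- exists (mnm_muln (mnm1 ord0) (N * M.+1)).
  by rewrite ideal_exp1 //; apply: lead_graded1.
- move=> c nc i; rewrite ltnNge; apply/negP => ci; apply: nc.
  rewrite ideal_exp1 //; apply: lead_mdeg (@graded_contains_exp M) _.
  by rewrite muln1 in ci; apply: leq_trans ci _; rewrite mdegE (bigD1 i) //= leq_addr.
- move=> c; rewrite ideal_exp1 // => /(lead_graded_div p) /(leadX j (ha _)).
  by congr (lead _ _ _); apply/mnmP => i; rewrite mnmDE !mulmnE mnmDE !mulmnE; ring.
Qed.

(** For a leading exponent [c] of degree below [D], each non-leading exponent has some coordinate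
    [i] below [c i]. The slabs so defined have total width [mdeg c]. *)
Lemma colen_notin_exp p f D : a p.+1 f -> ~ ideal_exp m D f ->
  (colen p.+1 1 <= D * (N * p.+1) ^ n)%N.
Proof.
move=> af /(lead_of_notin_exp (ha p.+1) af)[c [cD lc]].
pose slab i := finset_of [set b : {ffun 'I_n.+1 -> 'I_(N * p.+1 * 1)} | (b i < c i)%N].
have sub : colead x (N * p.+1 * 1) (ideal_exp (a p.+1) 1) \subset
    \big[@finset.setU _/finset.set0]_i slab i.
  apply/fintype.subsetP => b /finset_ofP; rewrite ideal_exp1 // => nb.
  apply/finset.bigcupP; apply: contrapT => nslab; apply: nb.
  apply: lead_le lc => // i; rewrite leqNgt boxE; apply/negP => bi.
  by apply: nslab; exists i => //; apply/finset_ofP.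
apply: leq_trans (subset_leq_card sub) _.
apply: (@leq_trans (\sum_i c i * (N * p.+1) ^ n)%N); last first.
  by rewrite -big_distrl leq_mul2r -mdegE (ltnW cD) orbT.
elim/big_rec2: _ => [|i k S _ Sk]; first by rewrite cards0.
rewrite cardsU; apply: leq_trans (leq_subr _ _) (leq_add _ Sk).
by apply: leq_trans (card_slab _ _ _) _; rewrite muln1.
Qed.

End GradedLeading.

(** * Artin-Rees and the growth of the length *)

Section Dickson.

(** [g k] is an index from [k] on at which [u] is least on that range; each [phi i.+1] is taken this
    way past [phi i]. *)
Lemma nat_nondecreasing_subseq (u : nat -> nat) : exists phi : nat -> nat,
  (forall i, phi i < phi i.+1)%N /\ forall i, (u (phi i) <= u (phi i.+1))%N.
Proof.
have /choice[g gP] k : exists j, (k <= j)%N /\ forall i, (k <= i)%N -> (u j <= u i)%N.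
  have ex : exists v, `[< exists2 j, (k <= j)%N & u j = v >].
    by exists (u k); apply/asboolP; exists k.
  case: (ex_minnP ex) => _ /asboolP[j kj <-] umin.
  by exists j; split=> // i ki; apply: umin; apply/asboolP; exists i.
pose phi := fix phi i := if i is i'.+1 then g (phi i').+1 else g 0%N.
have phiS i : (phi i < phi i.+1)%N by case: (gP (phi i).+1).
exists phi; split=> // i; case: i (phiS i) => [|i] lt.
  by case: (gP 0%N) => _; apply.
by case: (gP (phi i).+1) => gi; apply; apply: leq_trans gi (ltnW lt).
Qed.

Lemma multinom_nondecreasing_subseq n (c : nat -> multinom n) : exists phi : nat -> nat,
  (forall i, phi i < phi i.+1)%N /\
  forall i k, (c (phi i) k <= c (phi i.+1) k)%N.
Proof.
suff [phi [phiS phic]] : exists phi : nat -> nat, (forall i, phi i < phi i.+1)%N /\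
    {in enum 'I_n, forall k i, (c (phi i) k <= c (phi i.+1) k)%N}.
  by exists phi; split=> // i k; apply: phic; rewrite mem_enum.
elim: (enum _) => [|k s [phi [phiS phic]]]; first by exists id; split.
have [psi [psiS psic]] := nat_nondecreasing_subseq (fun i => c (phi i) k).
exists (phi \o psi); split=> [i|k'] /=.
  by apply: (homo_ltn ltn_trans phiS).
rewrite inE => /predU1P[->|/phic k's i]; first exact: psic.
exact: (homo_leq (@leqnn) leq_trans k's) (ltnW (psiS i)).
Qed.

(** From counterexamples for every [s], a subsequence with nondecreasing exponents is extracted. Its
    ideals stabilise, so that of a late member is contained in that of an early one, whose degree is
    by then within the bound. *)
Lemma dickson_noetherian (R : comNzRingType) n (C : multinom n -> set R) :
  noetherian R -> (forall c, is_ideal (C c)) ->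
  (forall c d : multinom n, (forall i, c i <= d i)%N -> C c `<=` C d) ->
  exists s, forall c : multinom n, exists d : multinom n,
    [/\ forall i, (d i <= c i)%N, (mdeg d <= s)%N & C c `<=` C d].
Proof.
move=> noeth hC Cle; apply: contrapT => /forallNP ns.
have /choice[c cP] s : exists c : multinom n, forall d : multinom n,
    (forall i, d i <= c i)%N -> (mdeg d <= s)%N -> ~ C c `<=` C d.
  have /existsNP[c /forallNP nc] := ns s.
  by exists c => d dc ds Cd; apply: (nc d).
have [phi [phiS phic]] := multinom_nondecreasing_subseq c.
have phi_id i : (i <= phi i)%N.
  by elim: i => // i ih; apply: leq_ltn_trans ih (phiS i).
have phi_le i j k : (i <= j)%N -> (c (phi i) k <= c (phi j) k)%N.
  by apply: (homo_leq (@leqnn) leq_trans (fun i => phic i k)).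
have [|N hN] := noetherian_acc noeth (fun i => hC (c (phi i))).
  by move=> i; apply: Cle => k; apply: phi_le.
pose i := maxn N (mdeg (c (phi N))).
apply: (cP (phi i) (c (phi N))).
- by move=> k; apply: phi_le; apply: leq_maxl.
- exact: leq_trans (leq_maxr _ _) (phi_id _).
- by apply: hN; apply: leq_maxl.
Qed.

End Dickson.

(** * The Artin-Rees lemma and division modulo a prime *)

Section ArtinRees.
Variables (R : comNzRingType) (n : nat) (x : 'I_n -> R).
Hypothesis noeth : noetherian R.
Notation m := (ideal_gen x).
Notation mono := (mono x).
Notation mspan := (mspan x).

(* [J] meets [m^k] in combinations of monomials of degree [k]; their leading
   coefficients in [J] form ideals growing with the monomial, so by Dickson's
   lemma each of them already occurs in bounded degree. *)
Lemma artin_rees (J : set R) : is_ideal J ->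
  exists s, forall k, ideal_exp m k `&` J `<=` ideal_mul (ideal_exp m (k - s)) J.
Proof.
move=> hJ; have hm := ideal_gen_ideal x.
pose htail c := mspan [set b | mdeg b = mdeg c /\ (c < b)%O].
have hT c : is_ideal (htail c) by apply: mspan_ideal.
have htailM (c d : multinom n) h : htail c h -> htail (mnm_add d c) (mono d * h).
  apply: mspanM => b /= [bc cb]; split; last by rewrite ltmc_add2r.
  by rewrite !mdegD bc.
pose C c : set R := [set r | exists h, htail c h /\ J (r * mono c + h)].
have hC c : is_ideal (C c).
  split=> [|r r' [h [ch Jh]] [h' [ch' Jh']]|r r' [h [ch Jh]]].
  - by exists 0; rewrite mul0r addr0; split; [exact: ideal0 (hT c)|exact: ideal0].
  - exists (h + h'); rewrite mulrDl addrACA.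
    by split; [exact: (idealD (hT c))|exact: idealD].
  - exists (r * h); rewrite -mulrA -mulrDr.
    by split; [exact: (idealMl _ (hT c))|exact: idealMl].
have Cle (c d : multinom n) : (forall i, c i <= d i)%N -> C c `<=` C d.
  move=> /mnm_lepP /submK cd r [h [ch Jh]].
  exists (mono (mnm_sub d c) * h); split; first by rewrite -[X in htail X]cd; apply: htailM.
  rewrite -[X in mono X]cd monoD mulrCA -mulrDr; exact: idealMl.
have [s sP] := dickson_noetherian noeth hC Cle.
exists s => k f [/exp_mspan kf Jf].
have hI : is_ideal (ideal_mul (ideal_exp m (k - s)) J).
  exact/ideal_mul_ideal/ideal_exp_ideal.
suff main U : upset U -> J `&` mspan [set c | mdeg c = k /\ U c] `<=`
    ideal_mul (ideal_exp m (k - s)) J.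
  apply: (main setT) => //; split=> //; apply: mspanS kf => c /= ck; by split.
move: U; apply: (@upset_ind _ k.+1) => [U Uk g [_]|U a upU Ua amin ak ih g [Jg]].
  by apply: mspan_min => // c [ck /Uk]; rewrite ck ltnn.
have [ak'|ak'] := ltnP (mdeg a) k.
  move=> Ug; apply: ih; split=> //; apply: mspanS Ug => c /= [ck Uc]; split=> //.
  by apply: lt_mdeg_ltmc; rewrite ck.
have {ak ak'}ak : mdeg a = k by apply/eqP; rewrite eqn_leq -ltnS ak.
move=> /(mspanU1 (S' := [set c | mdeg c = k /\ (a < c)%O]) (a := a)) [].
  by move=> c [ck /amin]; rewrite le_eqVlt => /predU1P[->|ac]; [left|right].
move=> r [h [ah eg]].
have Car : C a r by exists h; rewrite -eg /htail ak.
have [d [da ds Cad]] := sP a; have [h' [dh' Jh']] := Cad _ Car.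
have /mnm_lepP/submK ea := da.
(* The coefficient [r] also occurs at [d], of degree at most [s]. A monomial multiple of that
   element of [J] cancels the term at [a], and the multiplier has degree at least [k - s]. *)
rewrite -(subrK (mono (mnm_sub a d) * (r * mono d + h')) g).
apply: (idealD hI).
  apply: ih; split; first by apply: idealB => //; apply: idealMl.
  have -> : g - mono (mnm_sub a d) * (r * mono d + h') = h - mono (mnm_sub a d) * h'.
    by rewrite eg -[in mono a]ea monoD; ring.
  apply: (idealB (mspan_ideal _ _)) => //.
  by have := htailM _ (mnm_sub a d) _ dh'; rewrite ea /htail ak.
apply: ideal_mul_mem => //; apply: ideal_exp_le (exp_mono x _) => //.
by rewrite -ak -[in mdeg a]ea mdegD leq_subLR addnC leq_add2r.
Qed.

(** Artin-Rees for P + (y): the part of [y * r] in m^k equals y h' modulo [P] for some h' in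
    m^(k-s), and primality cancels [y] in y (r - h'). *)
Lemma prime_colon_exp (P : set R) y : is_prime_ideal P -> ~ P y ->
  exists s, forall k r, iadd P (ideal_exp m k) (y * r) ->
    iadd P (ideal_exp m (k - s)) r.
Proof.
case=> hP _ primeP nPy; have hm := ideal_gen_ideal x.
have hJ := iadd_ideal hP (principal_ideal y).
have [s sP] := artin_rees hJ; exists s => k r [p [h [Pp kh eyr]]].
have : ideal_mul (ideal_exp m (k - s)) (iadd P (principal y)) h.
  apply: sP; split=> //; exists (- p), (r * y).
  by split; [exact: idealN|exists r|rewrite [r * y]mulrC eyr addKr].
have hE := @ideal_exp_ideal _ m (k - s) hm.
move/(@ideal_mul_min _ _ _ [set g | exists2 h', ideal_exp m (k - s) h' & P (g - y * h')]).
case=> [|f _ ef [q [_ [Pq [u ->] ->]]]|h' eh' Phh'].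
- split=> [|g g' [h1 eh1 Ph1] [h2 eh2 Ph2]|c g [h1 eh1 Ph1]].
  + by exists 0; [exact: ideal0|rewrite mulr0 subr0; apply: ideal0].
  + exists (h1 + h2); first exact: idealD.
    by rewrite mulrDr opprD addrACA; apply: idealD.
  + exists (c * h1); first exact: idealMl.
    by rewrite mulrCA -mulrBr; apply: idealMl.
- exists (f * u); first exact: idealMr.
  have -> : f * (q + u * y) - y * (f * u) = f * q by ring.
  exact: idealMl.
exists (r - h'), h'; split=> //; last by rewrite subrK.
have : P (y * (r - h')).
  have -> : y * (r - h') = p + (h - y * h') by rewrite mulrBr eyr addrA.
  exact: idealD.
by case/primeP.
Qed.

End ArtinRees.

(** * Long chains of ideals from a chain of primes *)

Section Chains.
Variables (R : comNzRingType).
Implicit Types (C D : set (set R)).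

Lemma has_chainS C D k : C `<=` D -> has_chain C k -> has_chain D k.
Proof. by move=> CD [c [cC cs]]; exists c; split=> // i ik; apply/CD/cC. Qed.

Lemma has_chain_cat C k l (c d : nat -> set R) :
  (forall i, (i <= k)%N -> C (c i)) -> (forall i, (i < k)%N -> c i `<` c i.+1) ->
  (forall i, (i <= l)%N -> C (d i)) -> (forall i, (i < l)%N -> d i `<` d i.+1) ->
  c k `<=` d 0%N -> has_chain C (k + l).
Proof.
move=> cC cs dC ds cd.
(* [c k] gives way to [d 0], which contains it; the junction is then strict even if the two are
   equal. *)
exists (fun i => if (i < k)%N then c i else d (i - k)%N); split=> i ikl.
  case: ltnP => [ik|ki]; first exact/cC/ltnW.
  by apply: dC; rewrite leq_subLR.
case: (ltnP i k) => [ik|ki]; last first.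
  rewrite ltnNge (leq_trans ki (leqnSn _)) /= subSn //; apply: ds.
  by rewrite ltn_subLR.
case: (ltnP i.+1 k) => [ik1|ki1]; first exact: cs.
have {ki1}ek : i.+1 = k by apply/eqP; rewrite eqn_leq ik.
rewrite -ek subnn; have [ss nss] := cs _ ik; rewrite -ek in cd.
split; first exact: subset_trans ss cd.
by move=> dc; apply: nss; apply: subset_trans dc.
Qed.

End Chains.

Section PrimeChain.
Variables (R : comNzRingType) (n : nat) (x : 'I_n -> R).
Hypothesis noeth : noetherian R.
Notation m := (ideal_gen x).
Hypothesis local : is_local m.

(* Multiplication by an element [y] of the second prime outside the first
   embeds a chain above [P + m^(k-s)] below the ideals containing [P + (y)];
   this gives Pascal's recursion for the lengths. *)
Lemma prime_chain_length d (c : nat -> set R) :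
  (forall i, (i <= d)%N -> is_prime_ideal (c i)) ->
  (forall i, (i < d)%N -> c i `<` c i.+1) ->
  exists s, (0 < s)%N /\ forall t, has_chain
    [set J | is_ideal J /\ iadd (c 0%N) (ideal_exp m (s * t.+1)) `<=` J] 'C(t, d).
Proof.
have hm := ideal_gen_ideal x.
have hE k : is_ideal (ideal_exp m k) by apply: ideal_exp_ideal.
elim: d c => [|d ih] c cP cs.
  exists 1%N; split=> // t; rewrite bin0 mul1n.
  have [hc nc _] := cP 0%N (leqnn _).
  have hI := iadd_ideal hc (hE t.+1).
  exists (fun i => if i is 0%N then iadd (c 0%N) (ideal_exp m t.+1) else setT).
  split=> [[|i] _|[|//] _]; do ?by split.
  split=> // /(_ 1 Logic.I); suff: iadd (c 0%N) (ideal_exp m t.+1) `<=` m.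
    by move=> + I1 => /(_ _ I1); case: local => [[]].
  apply: iadd_min => //; first exact: local_proper nc.
  by rewrite -[X in _ `<=` X](ideal_exp1 hm); apply: ideal_exp_le.
have [||s1 [s1gt0 IH]] := ih (fun i => c i.+1).
- by move=> i id; apply: cP.
- by move=> i id; apply: cs.
have [hP _ _] := cP 0%N (leq0n _); have [hP1 _ _] := cP 1%N isT.
have [PP1 /existsNP[y /not_implyP[P1y nPy]]] := cs 0%N isT.
have [s' colonP] := prime_colon_exp x noeth (cP 0%N (leq0n _)) nPy.
(* [s1] serves the chain above [c 1]; the summand [s'] makes up for the power lost in dividing by
   [y]. *)
exists (s1 + s')%N; split; first by rewrite addn_gt0 s1gt0.
set s := (s1 + s')%N; elim=> [|t iht].
  exists (fun=> iadd (c 0%N) (ideal_exp m (s * 1))); split=> // i _.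
  by split=> //; apply: iadd_ideal.
have hI := iadd_ideal hP (hE (s * t.+2)%N).
set I := iadd (c 0%N) _ in hI *.
have [A [AI As]] := IH t; have [B [BI Bs]] := iht.
(* [yB i] is I + y B_i. This chain contributes C(t, d+1) to Pascal's rule, and [A] the summand C(t,
   d). *)
pose yB i := [set g | exists2 j, B i j & I (g - y * j)].
rewrite binS; apply: (@has_chain_cat _ _ _ _ yB A).
- move=> i ik; have [hB _] := BI _ ik; split.
    split=> [|g g' [j Bj Ij] [j' Bj' Ij']|r g [j Bj Ij]].
    + by exists 0; [exact: ideal0|rewrite mulr0 subr0; apply: ideal0].
    + exists (j + j'); first exact: idealD.
      by rewrite mulrDr opprD addrACA; apply: idealD.
    + exists (r * j); first exact: idealMl.
      by rewrite mulrCA -mulrBr; apply: idealMl.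
  by move=> g Ig; exists 0; [exact: ideal0|rewrite mulr0 subr0].
- move=> i ik; have [ss /existsNP[j /not_implyP[Bj nBj]]] := Bs _ ik.
  have [hB IB] := BI _ (ltnW ik).
  split; first by move=> g [j' Bj' Ij']; exists j' => //; apply: ss.
  move=> /(_ (y * j))[]; first by exists j => //; rewrite subrr; apply: ideal0.
  move=> j' Bj'; rewrite -mulrBr => /colonP Ijj'; apply: nBj.
  rewrite -(subrK j' j); apply: idealD => //; apply: IB.
  have : (s * t.+1 <= s * t.+2 - s')%N.
    by rewrite leq_subRL ?[(s * t.+2)%N]mulnS ?leq_add2r // /s; lia.
  move=> le; move: Ijj'; apply: iaddSS => //; exact: ideal_exp_le.
- move=> i ik; have [hA IA] := AI _ ik; split=> //; apply: iadd_min => //.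
    by apply: subset_trans (subset_trans _ IA); [exact: PP1|apply: iadd_subl].
  apply: subset_trans IA; apply: subset_trans (iadd_subr hP1).
  by apply: ideal_exp_le => //; rewrite /s; nia.
- exact: As.
have [hA IA] := AI 0%N (leq0n _).
have A1 : c 1%N `<=` A 0%N by apply: subset_trans IA; apply: iadd_subl.
have A2 : ideal_exp m (s1 * t.+1) `<=` A 0%N.
  by apply: subset_trans IA; apply: iadd_subr.
move=> g [j _ Ig]; rewrite -(subrK (y * j) g); apply: idealD => //; last first.
  by apply: idealMr => //; apply: A1.
move: Ig; apply: iadd_min => //; first exact: subset_trans A1.
by apply: subset_trans A2; apply: ideal_exp_le => //; rewrite /s; nia.
Qed.

End PrimeChain.

(** * Volume and multiplicity *)

(** Each factor (n - i) t of t^n n! is at most the factor n t - i of the falling factorial. *)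
Lemma expn_le_bin n t : (t ^ n <= 'C(n * t, n))%N.
Proof.
rewrite -(leq_pmul2r (fact_gt0 n)) bin_ffact -ffactnn !ffact_prod.
have -> : (t ^ n = \prod_(i < n) t)%N by rewrite prod_nat_const card_ord.
rewrite -big_split; apply: leq_prod => i _ /=.
case: t => [|t]; first by rewrite mul0n.
by rewrite mulnC mulnBl leq_sub2l // leq_pmulr.
Qed.

(** * Convergence to an infimum *)

Section Limits.
Variable K : realType.
Implicit Types u v : nat -> K.

Lemma archi_le (c e : K) : 0 < e -> exists N : nat, forall p, (N < p)%N -> c / p%:R < e.
Proof.
move=> e0; exists (Num.truncn `|c / e|); move=> p Np.
have p0 : 0 < p%:R :> K by rewrite ltr0n (leq_ltn_trans _ Np).
rewrite ltr_pdivrMr // mulrC -ltr_pdivrMr //.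
apply: le_lt_trans (ler_norm _) _; apply: lt_le_trans (truncnS_gt _) _.
by rewrite ler_nat.
Qed.

(** [M] is fixed with [u M] close to [w] before [p] grows. Two sequences appear because [v] is later
    either the density itself or, up to the factorial, the normalised multiplicity. *)
Lemma cvg_inf_squeeze u v (c w : K) :
  (forall y, (forall M, (0 < M)%N -> y <= u M) -> y <= w) ->
  (forall p, (0 < p)%N -> w <= v p) ->
  (forall M p, (0 < M)%N -> (0 < p)%N -> v p <= u M + c * M%:R / p%:R) ->
  v @ \oo --> w.
Proof.
move=> wglb wv vu; apply/cvgrPdist_le => /= e e0.
have e20 : 0 < e / 2 by rewrite divr_gt0.
have [M [M0 uM]] : exists M, (0 < M)%N /\ u M < w + e / 2.
  apply: contrapT => /forallNP nM.
  have : w + e / 2 <= w.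
    by apply: wglb => M M0; rewrite leNgt; apply/negP => uM; apply: (nM M).
  by rewrite gerDl leNgt e20.
have [N hN] := @archi_le (c * M%:R) _ e20.
near=> p.
have Np : (N < p)%N by near: p; exact: nbhs_infty_gt.
have p0 : (0 < p)%N by apply: leq_ltn_trans Np.
have := wv _ p0; have := vu _ _ M0 p0; have := hN _ Np.
rewrite distrC ler_norml; move: (_ / p%:R) => z; lra.
Unshelve. all: by end_near.
Qed.

End Limits.

Section Volume.
Variables (K : realType) (R : comNzRingType) (n : nat) (x : 'I_n.+1 -> R).
Notation m := (ideal_gen x).
Hypothesis unit_out : forall c : R, ~ m c -> exists u, u * c = 1.

Definition density (a : nat -> set R) p : K := fine (colength K (a p)) / p%:R ^+ n.+1.

Section Graded.
Variables (a : nat -> set R) (N : nat).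
Hypothesis a_graded : graded_sequence a.
Hypothesis a1N : ideal_exp m N `<=` a 1%N.

Let colenK p j := colength_exp unit_out a_graded a1N K p j.

Lemma densityE p : density a p.+1 = (colen x a N p.+1 1)%:R / p.+1%:R ^+ n.+1.
Proof. by rewrite /density (colength_graded unit_out a_graded a1N K). Qed.

Lemma density_ge0 p : 0 <= density a p.+1.
Proof. by rewrite densityE divr_ge0 // exprn_ge0. Qed.

Lemma density_exp_le M p j : (0 < M)%N -> (0 < p)%N -> (0 < j)%N ->
  density (ideal_exp (a p)) j <=
    p%:R ^+ n.+1 * (density a M + N%:R ^+ n.+1 * M%:R / p%:R).
Proof.
case: M p j => [|M] [|p] [|j] // _ _ _.
rewrite {1}/density colenK /= densityE ler_pdivrMr ?exprn_gt0 ?ltr0n //.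
have := colen_div_bound a_graded a1N M p j.+1.
set k := (p.+1 %/ M.+1)%N; set r := (p.+1 %% M.+1)%N.
set c := colen _ _ _ _ _; set l := colen _ _ _ _ _.
have rM : r%:R <= M.+1%:R :> K by rewrite ler_nat ltnW // ltn_mod.
have kM : (k * M.+1)%:R <= p.+1%:R :> K by rewrite ler_nat leq_trunc_div.
rewrite -(ler_nat K) !(natrD, natrM, natrX) in kM *.
move=> /le_trans; apply.
have M0 : 0 < M.+1%:R :> K by rewrite ltr0n.
have p0 : 0 < p.+1%:R :> K by rewrite ltr0n.
have kpM : k%:R <= p.+1%:R / M.+1%:R :> K by rewrite ler_pdivlMr.
move: (k%:R) (r%:R) (M.+1%:R) (p.+1%:R) (j.+1%:R : K) (N%:R : K) (c%:R : K) (l%:R : K)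
  (ler0n K k) (ler0n K j.+1) (ler0n K N) (ler0n K l) rM kpM M0 p0.
move=> {c l kM} k' r' M' p' j' N' _ l' k0 j0 N0 l0 rM kpM M0 p0.
(* Clearing denominators separates the slab term from the dilation term; these are compared one by
   one through r <= M and k <= p / M. *)
have -> : p' ^+ n.+1 * (l' / M' ^+ n.+1 + N' ^+ n.+1 * M' / p') * j' ^+ n.+1 =
    N' * M' * j' * (N' * p' * j') ^+ n + (p' / M' * j') ^+ n.+1 * l'.
  rewrite !exprMn exprVn !exprS; field.
  by rewrite expf_neq0 ?lt0r_neq0.
apply: lerD.
  rewrite ler_wpM2r ?exprn_ge0 ?mulr_ge0 ?(ltW p0) //.
  by rewrite ler_wpM2r // ler_wpM2l.
rewrite ler_wpM2r // lerXn2r ?nnegrE ?mulr_ge0 ?invr_ge0 ?(ltW p0) ?(ltW M0) //.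
by rewrite ler_wpM2r.
Qed.

Lemma density_exp_ge p j : (0 < p)%N -> (0 < j)%N ->
  p%:R ^+ n.+1 * density a (p * j) <= density (ideal_exp (a p)) j.
Proof.
case: p j => [|p] [|j] // _ _; rewrite mulnS addSn -addSn -mulnS.
rewrite -[(p.+1 * j.+1)%N]prednK ?muln_gt0 // densityE prednK ?muln_gt0 //.
rewrite /density colenK /= natrM exprMn invfM mulrCA mulVKf ?expf_neq0 ?pnatr_eq0 //.
by rewrite ler_wpM2r ?invr_ge0 ?exprn_ge0 // ler_nat (colen_graded_le x).
Qed.

Lemma density_le M p : (0 < M)%N -> (0 < p)%N ->
  density a p <= density a M + N%:R ^+ n.+1 * M%:R / p%:R.
Proof.
move=> M0 p0; have := density_exp_le M0 p0 (ltn0Sn 0).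
have := density_exp_ge p0 (ltn0Sn 0); rewrite muln1 => /le_trans/[apply].
by rewrite ler_pM2l // exprn_gt0 // ltr0n.
Qed.

(** The shift [M.+1] leaves out the index 0, where the density is 0 by the convention on division
    and would spoil the infimum. *)
Definition asymptotic_density : K := inf [set density a M.+1 | M in setT].

Lemma asymptotic_density_le M : (0 < M)%N -> asymptotic_density <= density a M.
Proof.
case: M => // M _; apply: ge_inf; last by exists M.
by exists 0 => _ [p _ <-]; apply: density_ge0.
Qed.

Lemma asymptotic_density_glb y :
  (forall M, (0 < M)%N -> y <= density a M) -> y <= asymptotic_density.
Proof.
move=> yM; apply: lb_le_inf; first by exists (density a 1%N); exists 0%N.
by move=> _ [M _ <-]; apply: yM.
Qed.

Lemma cvg_colength :
  ((((n.+1)`!)%:R / p%:R ^+ n.+1)%:E * colength K (a p))%E @[p --> \oo] -->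
    (((n.+1)`!)%:R * asymptotic_density)%:E.
Proof.
have : (fun p => ((n.+1)`!%:R * density a p)%:E) @ \oo -->
    ((n.+1)`!%:R * asymptotic_density)%:E.
  apply/cvg_EFin; first by near=> p.
  rewrite [X in X @ _](_ : _ = fun p => (n.+1)`!%:R * density a p) //; apply: cvgMl_tmp.
  apply: (@cvg_inf_squeeze _ (density a) _ (N%:R ^+ n.+1)).
  - exact: asymptotic_density_glb.
  - exact: asymptotic_density_le.
  - exact: density_le.
apply: cvg_trans; apply: near_eq_cvg; exists 1%N => // -[//|p] _.
rewrite /density (colength_graded unit_out a_graded a1N K) /=.
by rewrite -EFinM; congr (_%:E); rewrite mulrAC mulrA.
Unshelve. all: by end_near.
Qed.

Lemma seq_volE : seq_vol K n.+1 a = ((n.+1)`!%:R * asymptotic_density)%:E.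
Proof. by have [_] := cvg_limn_einf_sup cvg_colength. Qed.

End Graded.

Lemma exp_graded (I : set R) : is_ideal I -> graded_sequence (ideal_exp I).
Proof.
move=> hI; split=> [p|p q]; first exact: ideal_exp_ideal.
apply: ideal_mul_min; first exact: ideal_exp_ideal.
by move=> f g; apply: ideal_expD.
Qed.

(** Each e(a_p) is the factorial times the asymptotic density of the powers of a_p; divided by the
    power of p, this is squeezed like the density of [a] itself. *)
Lemma seq_multE (a : nat -> set R) N : graded_sequence a -> ideal_exp m N `<=` a 1%N ->
  seq_mult K n.+1 a = ((n.+1)`!%:R * asymptotic_density a)%:E.
Proof.
move=> a_graded a1N.
have ha p : is_ideal (a p) by case: a_graded.
have exp_gr p := exp_graded (ha p).
have exp1 p : ideal_exp m (N * p.+1) `<=` ideal_exp (a p.+1) 1.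
  by rewrite ideal_exp1 //; apply: graded_contains_exp.
pose w p := asymptotic_density (ideal_exp (a p)).
have hsE p : hs_mult K n.+1 (a p.+1) = ((n.+1)`!%:R * w p.+1)%:E.
  exact/cvg_lim/(cvg_colength (exp_gr p.+1) (exp1 p)).
apply/cvg_lim => //.
have : (fun p => ((n.+1)`!%:R * (w p / p%:R ^+ n.+1))%:E) @ \oo -->
    ((n.+1)`!%:R * asymptotic_density a)%:E.
  apply/cvg_EFin; first by near=> p.
  rewrite [X in X @ _](_ : _ = fun p => (n.+1)`!%:R * (w p / p%:R ^+ n.+1)) //; apply: cvgMl_tmp.
  apply: (@cvg_inf_squeeze _ (density a) _ (N%:R ^+ n.+1)).
  - exact: asymptotic_density_glb.
  - case=> // p _; rewrite ler_pdivlMr ?exprn_gt0 ?ltr0n // mulrC.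
    (* The lower bound uses (a_p)^j inside a_(p j) for every j; the upper bound, below, uses j = 1
       alone. *)
    apply: asymptotic_density_glb => j j0.
    apply: le_trans (density_exp_ge a_graded a1N (ltn0Sn p) j0).
    rewrite ler_wpM2l ?exprn_ge0 //.
    by apply: (asymptotic_density_le a_graded a1N); rewrite muln_gt0.
  - move=> M [//|p] M0 _; rewrite ler_pdivrMr ?exprn_gt0 ?ltr0n // mulrC.
    apply: le_trans (density_exp_le a_graded a1N M0 (ltn0Sn p) (ltn0Sn 0)).
    exact: (asymptotic_density_le (exp_gr p.+1) (exp1 p)).
apply: cvg_trans; apply: near_eq_cvg; exists 1%N => // -[//|p] _.
rewrite hsE -EFinM; congr (_%:E).
by rewrite mulrA mulrC.
Unshelve. all: by end_near.
Qed.

End Volume.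

(** * Positivity *)

Section Positivity.
Variables (K : realType) (R : comNzRingType) (n : nat) (x : 'I_n.+1 -> R).
Notation m := (ideal_gen x).
Hypotheses (noeth : noetherian R) (local : is_local m).
Variables (a : nat -> set R) (N : nat).
Hypothesis a_graded : graded_sequence a.
Hypothesis a1N : ideal_exp m N `<=` a 1%N.

Let unit_out : forall c : R, ~ m c -> exists u, u * c = 1 := local_unit noeth local.

Lemma asymptotic_density_gt0_exp : 0 < asymptotic_density K n a ->
  exists q, (1 <= q)%N /\ forall p, a p `<=` ideal_exp m (p %/ q).
Proof.
move=> w0; have [q0 q0P] := archi_le (N%:R ^+ n) w0.
exists q0.+1; split=> // p f; apply: contraPP => npf apf.
case: p => [|p] in npf apf *; first by apply: npf; rewrite div0n.
have := colen_notin_exp unit_out N a_graded apf npf.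
set c := colen _ _ _ _ _; set d := (_ %/ _)%N => cd.
have : asymptotic_density K n a <= N%:R ^+ n / q0.+1%:R.
  apply: le_trans (asymptotic_density_le K unit_out a_graded a1N (ltn0Sn p)) _.
  rewrite (densityE K unit_out a_graded a1N) ler_pdivrMr ?exprn_gt0 ?ltr0n //.
  apply: (@le_trans _ _ (d * (N * p.+1) ^ n)%:R); first by rewrite ler_nat.
  rewrite mulrAC ler_pdivlMr ?ltr0n // !(natrM, natrX) exprMn.
  rewrite -!(natrM, natrX) ler_nat.
  rewrite mulnAC (leq_trans (n := (p.+1 * (N ^ n * p.+1 ^ n))%N)) //.
    by rewrite leq_mul2r leq_trunc_div orbT.
  by rewrite mulnCA -expnS.
by rewrite leNgt q0P.
Qed.

Lemma exp_asymptotic_density_gt0 q : krull_dim_is R n.+1 -> (1 <= q)%N ->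
  (forall p, a p `<=` ideal_exp m (p %/ q)) -> 0 < asymptotic_density K n a.
Proof.
case=> -[c [cP cs]] _ q0 aq.
have [s [s0 chainP]] := prime_chain_length noeth local cP cs.
have [hc _ _] := cP 0%N (leq0n _).
(* For p = q s (t+1) the ideal a_p lies in m^(s (t+1)), so the chain obtained from the primes lies
   above a_p. *)
have bin_le t : ('C(t, n.+1) <= colen x a N (q * (s * t.+1)) 1)%N.
  have [p ep] : exists p, (q * (s * t.+1) = p.+1)%N.
    by exists (q * (s * t.+1)).-1%N; rewrite prednK // !muln_gt0 q0 s0.
  have ha : is_ideal (a p.+1) by case: a_graded.
  rewrite ep; apply: (@chain_leq_colead _ _ x unit_out _ (N * p.+1)).
  - by rewrite ideal_exp1 //; apply: graded_contains_exp.
  - by rewrite muln1.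
  apply: has_chainS (chainP t) => J [hJ IJ]; split=> //; apply: subset_trans IJ.
  rewrite ideal_exp1 //; apply: subset_trans (iadd_subr hc).
  by have := aq p.+1; rewrite -ep mulKn.
(* For p = q s ((n+1) t + 1) with t >= 1, one has p <= q s (n+2) t, while the length is at least
   C((n+1) t, n+1) >= t^(n+1); hence the density at p is at least [e]. *)
pose e : K := ((q * s * n.+2) ^ n.+1)%:R^-1.
have e0 : 0 < e by rewrite invr_gt0 ltr0n expn_gt0 !muln_gt0 q0 s0.
apply: lt_le_trans e0 _; apply: asymptotic_density_glb => M M0.
(* The bound is shown for special p only; these being arbitrarily large, [density_le] carries it
   over to every [M] up to [eps]. *)
apply/ler_addgt0Pr => eps eps0.
have [t0 t0P] := archi_le (N%:R ^+ n.+1 * M%:R) eps0.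
set t := t0.+1; pose p := (q * (s * (n.+1 * t).+1))%N.
have p0 : (0 < p)%N by rewrite !muln_gt0 q0 s0.
have pt : (t0 < p)%N.
  rewrite /p mulnA; apply: (@leq_trans (1 * (n.+1 * t).+1)); last first.
    by rewrite leq_mul2r muln_gt0 q0 s0.
  by rewrite mul1n /t; nia.
have := density_le K unit_out a_graded a1N M0 p0.
have := t0P p pt; move: (_ / p%:R) => z zeps le_z.
suff : e <= density K n a p by move: (density _ _ _ _) le_z => ? ? ?; lra.
rewrite -(prednK p0) (densityE K unit_out a_graded a1N) (prednK p0).
rewrite ler_pdivlMr ?exprn_gt0 ?ltr0n // mulrC ler_pdivrMr; last first.
  by rewrite ltr0n expn_gt0 !muln_gt0 q0 s0.
rewrite -!(natrX, natrM) ler_nat.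
apply: (@leq_trans (t ^ n.+1 * (q * s * n.+2) ^ n.+1)).
  rewrite -expnMn leq_exp2r // /p (_ : t * _ = q * (s * (n.+2 * t)))%N; last by ring.
  by rewrite !leq_mul2l [X in (_ < X)%N]mulSn /t; apply/orP; right; apply/orP; right; lia.
by rewrite leq_mul2r (leq_trans (expn_le_bin _ _) (bin_le _)) orbT.
Qed.

End Positivity.

Theorem theorem1p7 (K : realType) (R : comNzRingType) (m : set R) (n : nat)
    (hn : (1 <= n)%N) (hreg : regular_local m n) (hfield : contains_field R)
    (a : nat -> set R) (hgr : graded_sequence a)
    (hzd : forall p, zero_dim_ideal (a p)) :
  seq_vol K n a = seq_mult K n a /\
  ((0 < seq_vol K n a)%E <->
   exists q : nat, (1 <= q)%N /\
     forall p : nat, a p `<=` ideal_exp m (p %/ q)).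
Proof.
case: n hn hreg => // n _ [noeth local dimR [x mx]].
have [N a1N] := zero_dim_exp noeth local mx (hzd 1%N).
rewrite mx in local a1N *; have unit_out := local_unit noeth local.
rewrite (seq_volE K unit_out hgr a1N) (seq_multE K unit_out hgr a1N); split=> //.
rewrite lte_fin pmulr_rgt0 ?ltr0n ?fact_gt0 //; split.
  exact: (asymptotic_density_gt0_exp noeth local hgr a1N).
by case=> q [q0]; apply: (exp_asymptotic_density_gt0 K noeth local hgr a1N).
Qed.
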